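(* Let $P\subset\mathbb{R}^N$ be a polytope with vertex set $\{v_1,\dots,v_M\}$, and let $v:\mathbb{R}^N\to\{v_1,\dots,v_M\}$ be a map assigning to each $x$ a vertex of $P$ closest to $x$ in the Euclidean norm (with some fixed tie-breaking rule when several vertices are equally close). For each $\gamma\in P$ define $\phi_\gamma:\mathbb{R}^N\to\mathbb{R}^N$ by $$\phi_\gamma(x)=x+(\gamma-v(x)).$$ Then for every compact set $K\subset\mathbb{R}^N$ there exists a bounded convex set $Q\subset\mathbb{R}^N$ with $K\subset Q$ such that $\phi_\gamma(Q)\subset Q$ for all $\gamma\in P$.
   Context: A polytope is the convex hull of a finite set of points in $\mathbb{R}^N$; its vertices are its extreme points. The tie-breaking rule is arbitrary but fixed, so $v$ is a well-defined function with $\|x-v(x)\|=\min_i\|x-v_i\|$ for all $x$. *)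

(* Defs.v *)
From HB Require Import structures.
From mathcomp Require Import all_boot all_order all_algebra.
From mathcomp Require Import all_classical all_reals all_analysis.
Set Implicit Arguments. Unset Strict Implicit. Unset Printing Implicit Defensive.
Import Order.TTheory GRing.Theory Num.Theory.
Import numFieldNormedType.Exports.
Local Open Scope classical_set_scope.
Local Open Scope ring_scope.

Section Defs.
Variables (R : realType) (N : nat).

Definition eucl_sqnorm (x : 'rV[R]_N) : R := \sum_(i < N) (x ord0 i) ^+ 2.
Definition eucl_sqdist (x y : 'rV[R]_N) : R := eucl_sqnorm (x - y).

Definition conv_hull (S : seq 'rV[R]_N) : set 'rV[R]_N :=
  [set x | exists l : 'I_(size S) -> R,
     (forall i, 0 <= l i) /\ \sum_(i < size S) l i = 1 /\
     x = \sum_(i < size S) l i *: S`_i].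

Definition extreme_pt (A : set 'rV[R]_N) (x : 'rV[R]_N) : Prop :=
  A x /\ forall y z t, A y -> A z -> 0 < t -> t < 1 ->
     x = t *: y + (1 - t) *: z -> y = z.

Definition convex_pts (Q : set 'rV[R]_N) : Prop :=
  forall x y t, Q x -> Q y -> 0 <= t -> t <= 1 -> Q (t *: x + (1 - t) *: y).

Definition eucl_bounded (Q : set 'rV[R]_N) : Prop :=
  exists M : R, forall x, Q x -> eucl_sqnorm x <= M.
End Defs.

(* Main.v *)
(** Let [D] be the set of differences of the points of [S].  The invariant set
    consists of the [x] such that, for every linearly independent list [ds] in
    [D], the orthogonal projection of [x] onto the complement of [ds] has
    squared norm at most [q k], where [k] is the length of [ds] and [q] is
    decreasing, with gaps growing geometrically.

    Suppose that [x] lies in this set, that [w] is a vertex, and put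
    [d = v x - w].  Let [p] be the projection along [ds] and [e = p d].  The
    squared norm of [p (x - d)] exceeds that of [p x] by [|e|^2 - 2 <p x, e>],
    so only the case of a small or negative [<p x, e>] matters.  In that case
    [<x, d>] is bounded below because [v x] is a nearest vertex, and
    [x - p x] is short unless [p x] is far inside its ball, so [<p x, e>]
    cannot be very negative; hence [|p x|^2] is close to the squared norm of
    the projection along [d :: ds], which is at most [q (k + 1)].  The gap
    between [q (k + 1)] and [q k] absorbs the error.  Finally, a point of the
    polytope is a convex combination of vertices, and the invariant set is
    convex. *)

Require Import Defs.
From HB Require Import structures.
From mathcomp Require Import all_boot all_order all_algebra.
From mathcomp Require Import all_classical all_reals all_analysis.
From mathcomp Require Import ring lra.
Set Implicit Arguments. Unset Strict Implicit. Unset Printing Implicit Defensive.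
Import Order.TTheory GRing.Theory Num.Theory.
Import numFieldNormedType.Exports.
Local Open Scope classical_set_scope.
Local Open Scope ring_scope.

(** * Inner product, Gram-Schmidt and orthogonal projections *)

Section InnerProduct.
Context {R : realType} {N : nat}.
Implicit Types x y z d : 'rV[R]_N.
Implicit Types ds : seq 'rV[R]_N.

Definition dot x y : R := \sum_(i < N) x ord0 i * y ord0 i.

Lemma eucl_sqnormE x : eucl_sqnorm x = dot x x.
Proof. by apply: eq_bigr => i _; rewrite expr2. Qed.

Lemma dotC x y : dot x y = dot y x.
Proof. by apply: eq_bigr => i _; rewrite mulrC. Qed.

Lemma dotDl x y z : dot (x + y) z = dot x z + dot y z.
Proof. by rewrite -big_split; apply: eq_bigr => i _; rewrite mxE mulrDl. Qed.

Lemma dotZl a x y : dot (a *: x) y = a * dot x y.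
Proof. by rewrite mulr_sumr; apply: eq_bigr => i _; rewrite mxE mulrA. Qed.

Lemma dotNl x y : dot (- x) y = - dot x y.
Proof. by rewrite -scaleN1r dotZl mulN1r. Qed.

Lemma dotDr x y z : dot z (x + y) = dot z x + dot z y.
Proof. by rewrite dotC dotDl !(dotC z). Qed.

Lemma dotZr a x y : dot y (a *: x) = a * dot y x.
Proof. by rewrite dotC dotZl dotC. Qed.

Lemma dotNr x y : dot y (- x) = - dot y x.
Proof. by rewrite dotC dotNl dotC. Qed.

Lemma dot0l x : dot 0 x = 0.
Proof. by rewrite -(scale0r 0) dotZl mul0r. Qed.

Lemma dot0r x : dot x 0 = 0.
Proof. by rewrite dotC dot0l. Qed.

Lemma dot_suml (I : finType) (f : I -> 'rV[R]_N) z :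
  dot (\sum_i f i) z = \sum_i dot (f i) z.
Proof. by apply: (big_morph (dot^~ z)) => [x y|]; rewrite ?dotDl ?dot0l. Qed.

Definition dotE := (dotDl, dotDr, dotNl, dotNr, dotZl, dotZr).

Lemma dot_ge0 x : 0 <= dot x x.
Proof. by rewrite -eucl_sqnormE sumr_ge0 // => i _; rewrite sqr_ge0. Qed.

Lemma dot_eq0 x : (dot x x == 0) = (x == 0).
Proof.
apply/idP/eqP => [|->]; last by rewrite dot0l.
rewrite psumr_eq0 => [/allP x0|i _]; last by rewrite -expr2 sqr_ge0.
apply/rowP => i; have := x0 i (mem_index_enum _).
by rewrite mulf_eq0 orbb mxE => /eqP.
Qed.

Lemma dot_gt0 x : (0 < dot x x) = (x != 0).
Proof. by rewrite lt_def dot_ge0 andbT dot_eq0. Qed.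

Lemma dot_CauchySchwarz x y : dot x y ^+ 2 <= dot x x * dot y y.
Proof.
have [->|y0] := eqVneq y 0; first by rewrite !dot0r mulr0 expr0n.
have E0 : 0 < dot y y by rewrite dot_gt0.
have := dot_ge0 (dot y y *: x - dot x y *: y).
rewrite !dotE (dotC y x) => h.
rewrite -subr_ge0 -(pmulr_rge0 _ E0); lra.
Qed.

(** With z the combination, averaging 2<f i, z> <= |f i|^2 + |z|^2 over the weights gives 2|z|^2 <=
    M + |z|^2. *)
Lemma dot_convex_le (I : finType) (l : I -> R) (f : I -> 'rV[R]_N) M :
  (forall i, 0 <= l i) -> \sum_i l i = 1 ->
  (forall i, l i != 0 -> dot (f i) (f i) <= M) ->
  dot (\sum_i l i *: f i) (\sum_i l i *: f i) <= M.
Proof.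
move=> l0 l1 fM; set z := \sum_i _.
have zz : dot z z = \sum_i l i * dot (f i) z.
  by rewrite {1}/z dot_suml; apply: eq_bigr => i _; rewrite dotZl.
have : dot z z <= \sum_i l i * ((M + dot z z) / 2).
  rewrite {1}zz; apply: ler_sum => i _; have [->|li] := eqVneq (l i) 0.
    by rewrite !mul0r.
  apply: ler_wpM2l; first exact: l0.
  have := dot_ge0 (f i - z); rewrite !dotE (dotC z (f i)).
  by move: (fM i li); lra.
by rewrite -mulr_suml l1; lra.
Qed.

(* The orthogonal projection onto the orthogonal complement of [ds], by
   Gram-Schmidt; a vector [d] in the span of its successors is skipped, since
   then [dot e e] is [0] and so is the quotient by it. *)
Fixpoint oproj ds x : 'rV[R]_N :=
  if ds is d :: ds' then
    let e := oproj ds' d in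
    oproj ds' x - (dot (oproj ds' x) e / dot e e) *: e
  else x.

Lemma oproj_is_linear ds : linear (oproj ds).
Proof.
elim: ds => [|d ds IH] a x y //=; rewrite IH dotDl dotZl mulrDl scalerDl.
by rewrite scalerBr scalerA mulrA opprD !addrA; congr (_ - _); rewrite addrAC.
Qed.

HB.instance Definition _ ds :=
  GRing.isLinear.Build R 'rV[R]_N 'rV[R]_N _ (oproj ds) (oproj_is_linear ds).

Lemma dot_oproj_cons_head ds d x : dot (oproj (d :: ds) x) (oproj ds d) = 0.
Proof.
rewrite /= !dotE; have [->|e0] := eqVneq (oproj ds d) 0.
  by rewrite !dot0r mulr0 oppr0 addr0.
by rewrite divfK ?subrr // dot_eq0.
Qed.

Lemma dot_oproj ds x y : dot (oproj ds x) (oproj ds y) = dot (oproj ds x) y.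
Proof.
elim: ds x y => [//|d ds IH] x y.
rewrite [X in dot _ X]/= dotDr dotNr dotZr dot_oproj_cons_head mulr0 subr0.
by rewrite /= !dotDl !dotNl !dotZl !IH.
Qed.

(** Pythagoras: one more direction removes exactly the component along [e]. *)
Lemma dot_oproj_cons ds d x (e := oproj ds d) :
  dot (oproj (d :: ds) x) (oproj (d :: ds) x) =
  dot (oproj ds x) (oproj ds x) - dot (oproj ds x) e ^+ 2 / dot e e.
Proof.
rewrite [X in dot _ X]/= dotDr dotNr dotZr dot_oproj_cons_head mulr0 subr0.
by rewrite /= -/e !dotE (dotC e (oproj ds x)) mulrAC -expr2.
Qed.

Lemma dot_sub_oproj ds x :
  dot (x - oproj ds x) (x - oproj ds x) = dot x x - dot (oproj ds x) (oproj ds x).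
Proof. by rewrite !dotE dot_oproj (dotC x); ring. Qed.

Lemma dot_oproj_le ds x : dot (oproj ds x) (oproj ds x) <= dot x x.
Proof. by rewrite -subr_ge0 -dot_sub_oproj dot_ge0. Qed.

Lemma oproj_mem0 ds d : d \in ds -> oproj ds d = 0.
Proof.
elim: ds => [//|c ds IH]; rewrite inE => /predU1P[->|/IH h] /=; last first.
  by rewrite h dot0l mul0r scale0r subr0.
have [->|e0] := eqVneq (oproj ds c) 0; first by rewrite scaler0 subr0.
by rewrite divff ?scale1r ?subrr // dot_eq0.
Qed.

(** Linear independence, as nonvanishing of all Gram-Schmidt residuals. *)
Fixpoint indep ds : bool :=
  if ds is d :: ds' then (oproj ds' d != 0) && indep ds' else true.

Lemma indep_uniq ds : indep ds -> uniq ds.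
Proof.
elim: ds => [//|d ds IH] /= /andP[d0 /IH ->]; rewrite andbT.
by apply: contra d0 => /oproj_mem0 ->.
Qed.

End InnerProduct.

(** * Uniform bounds over finite families *)

Section FiniteBounds.
Context {R : realType}.

Lemma seq_ub {T : eqType} (s : seq T) (f : T -> R) :
  exists M : R, 0 < M /\ forall x, x \in s -> f x <= M.
Proof.
elim: s => [|a s [M [M0 IH]]]; first by exists 1.
exists (Num.max M (f a)); rewrite lt_max M0; split=> // x.
by rewrite inE le_max => /predU1P[->|/IH ->//]; rewrite lexx orbT.
Qed.

Lemma seq_pos_lb {T : eqType} (s : seq T) (f : T -> R) :
  exists c : R, 0 < c /\ forall x, x \in s -> 0 < f x -> c <= f x.
Proof.
have [M [M0 fM]] := seq_ub s (fun x => (f x)^-1).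
exists M^-1; rewrite invr_gt0; split=> // x xs fx.
by rewrite -[f x]invrK lef_pV2 ?posrE ?invr_gt0 // fM.
Qed.

End FiniteBounds.

(** Enumerating the lists of bounded length gives the nonzero |p d|^2 a common positive lower
    bound. *)
Fixpoint words {T : eqType} (D : seq T) n : seq (seq T) :=
  if n is n'.+1 then [::] :: [seq d :: w | d <- D, w <- words D n']
  else [:: [::]].

Lemma mem_words {T : eqType} (D : seq T) n w :
  {subset w <= D} -> (size w <= n)%N -> w \in words D n.
Proof.
elim: n w => [|n IH] [|d w] //= wD sw.
rewrite inE; apply: (allpairs_f cons); first by rewrite wD ?mem_head.
by apply: IH => // x xw; rewrite wD // inE xw orbT.
Qed.

(** * Polytopes and their extreme points *)

Section ConvexHull.
Context {R : realType} {N : nat}.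
Variable S : seq 'rV[R]_N.
Local Notation I := 'I_(size S).

Definition conv_coef (A : {set I}) (l : I -> R) : Prop :=
  [/\ forall i, 0 <= l i, \sum_i l i = 1 & forall i, i \notin A -> l i = 0].

Definition hull_on (A : {set I}) : set 'rV[R]_N :=
  [set x | exists2 l, conv_coef A l & x = \sum_i l i *: S`_i].

Lemma hull_on_trans (A B : {set I}) :
  (forall i, i \in A -> hull_on B S`_i) -> hull_on A `<=` hull_on B.
Proof.
move=> AB _ [a [a0 a1 aA] ->].
have /choice[L hL] : forall i, exists l : I -> R,
    i \in A -> conv_coef B l /\ S`_i = \sum_j l j *: S`_j.
  move=> i; have [/AB[l lB e]|nA] := boolP (i \in A); first by exists l.
  by exists (fun=> 0).
exists (fun j => \sum_i a i * L i j); last first.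
  under [RHS]eq_bigr do rewrite scaler_suml.
  rewrite exchange_big; apply: eq_bigr => i _ /=.
  under eq_bigr do rewrite -scalerA.
  rewrite -scaler_sumr; have [/hL[_ <-]//|/aA ->] := boolP (i \in A).
  by rewrite !scale0r.
split=> [j||j jB].
- apply: sumr_ge0 => i _; have [/hL[[L0 _ _] _]|/aA ->] := boolP (i \in A).
    by rewrite mulr_ge0.
  by rewrite mul0r.
- rewrite exchange_big -[RHS]a1; apply: eq_bigr => i _ /=; rewrite -mulr_sumr.
  have [/hL[[_ -> _] _]|/aA ->] := boolP (i \in A); first by rewrite mulr1.
  by rewrite mul0r.
- apply: big1 => i _; have [/hL[[_ _ ->//] _]|/aA ->] := boolP (i \in A).
    by rewrite mulr0.
  by rewrite mul0r.
Qed.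

Lemma hull_on_mem (A : {set I}) i : i \in A -> hull_on A S`_i.
Proof.
move=> iA; exists (fun j => (j == i)%:R).
  split=> [j||j]; first exact: ler0n.
    by rewrite (bigD1 i) //= eqxx big1 ?addr0 // => j /negPf ->.
  by apply: contraNeq; rewrite pnatr_eq0 eqb0 negbK => /eqP ->.
rewrite (bigD1 i) //= eqxx scale1r big1 ?addr0 // => j /negPf ->.
by rewrite scale0r.
Qed.

Lemma hull_onT : hull_on [set: I]%SET = conv_hull S.
Proof.
apply/seteqP; split=> x [l]; first by case=> l0 l1 _ ->; exists l.
by case=> l0 [l1 ->]; exists l => //; split=> // i; rewrite inE.
Qed.

Lemma conv_coef_eq1 (A : {set I}) l i : conv_coef A l -> l i = 1 ->
  \sum_j l j *: S`_j = S`_i.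
Proof.
move=> [l0 l1 _] li; rewrite (bigD1 i) //= li scale1r big1 ?addr0 // => j ji.
have : \sum_(j | j != i) l j = 0.
  by move: l1; rewrite (bigD1 i) //= li; lra.
move/eqP; rewrite psumr_eq0 // => /allP/(_ j (mem_index_enum _)).
by rewrite ji => /eqP ->; rewrite scale0r.
Qed.

Lemma conv_coef_le1 (A : {set I}) l i : conv_coef A l -> l i <= 1.
Proof.
by move=> [l0 <- _]; rewrite (bigD1 i) //= lerDl sumr_ge0.
Qed.

Lemma hull_on_split (A : {set I}) l i : conv_coef A l -> l i < 1 ->
  exists2 z, hull_on (A :\ i)%SET z &
    \sum_j l j *: S`_j = l i *: S`_i + (1 - l i) *: z.
Proof.
move=> [l0 l1 lA] li.
have k0 : 0 < 1 - l i by rewrite subr_gt0.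
pose c j := if j == i then 0 else l j / (1 - l i).
exists (\sum_j c j *: S`_j).
  exists c => //; split=> [j||j].
  - by rewrite /c; case: ifP => // _; rewrite divr_ge0 // ltW.
  - rewrite (bigD1 i) //= /c eqxx add0r.
    under eq_bigr => j /negPf -> do [].
    rewrite -mulr_suml; apply: (mulIf (lt0r_neq0 k0)).
    rewrite divfK ?lt0r_neq0 // mul1r.
    by move: l1; rewrite (bigD1 i) //=; lra.
  - rewrite /c !inE negb_and negbK => /orP[->//|/lA ->].
    by rewrite mul0r if_same.
rewrite (bigD1 i) //=; congr (_ + _).
rewrite [in RHS](bigD1 i) //= /c eqxx scale0r add0r scaler_sumr.
apply: eq_bigr => j /negPf ->.
by rewrite scalerA mulrCA divff ?mulr1 ?lt0r_neq0.
Qed.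

(** Minkowski's theorem: in a generating index set of least size every point is extreme, since
    otherwise it would lie in the hull of the others and could be dropped. *)
Lemma conv_hull_extreme x : conv_hull S x ->
  exists l : I -> R, [/\ forall i, 0 <= l i, \sum_i l i = 1,
    forall i, l i != 0 -> extreme_pt (conv_hull S) S`_i
  & x = \sum_i l i *: S`_i].
Proof.
pose gen n := `[< exists2 A : {set I}, #|A| = n & forall i : I, hull_on A S`_i >].
have exg : exists n, gen n.
  exists #|[set: I]%SET|; apply/asboolP; exists [set: I]%SET => // i.
  by apply: hull_on_mem; rewrite inE.
case: (ex_minnP exg) => _ /asboolP[A <- genA] minA Sx.
have hullA : conv_hull S `<=` hull_on A.
  by rewrite -hull_onT; apply: hull_on_trans.
have [l [l0 l1 lA] ->] := hullA _ Sx; exists l; split=> // i li.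
have iA : i \in A by apply: contraNT li => /lA ->.
split; first by rewrite -hull_onT; apply: hull_on_mem; rewrite inE.
move=> y z t /hullA[a aA ->] /hullA[b bA ->] t0 t1 e.
have [a0 a1 aS] := aA; have [b0 b1 bS] := bA.
pose c j := t * a j + (1 - t) * b j.
have cA : conv_coef A c.
  split=> [j||j jA]; first by rewrite addr_ge0 // mulr_ge0 // ?subr_ge0 ltW.
    by rewrite big_split /= -!mulr_sumr a1 b1; lra.
  by rewrite /c aS // bS // !mulr0 addr0.
have ec : S`_i = \sum_j c j *: S`_j.
  rewrite e !scaler_sumr -big_split; apply: eq_bigr => j _ /=.
  by rewrite !scalerA -scalerDl.
have ai := conv_coef_le1 i aA; have bi := conv_coef_le1 i bA.
have [ci|ci] := ltP (c i) 1; last first.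
  (* As 0 < t < 1, weight [c i] >= 1 forces [a i = b i = 1], so both endpoints are the point
     itself. *)
  by rewrite (conv_coef_eq1 (i := i) aA) ?(conv_coef_eq1 (i := i) bA) //;
     apply/eqP; rewrite eq_le ?ai ?bi /=; move: ci; rewrite /c; nra.
(* Otherwise the equation is solved for the point, which lands in the hull of the others. *)
have Si : hull_on (A :\ i)%SET S`_i.
  have [w Aw] := hull_on_split cA ci; rewrite -ec => ew.
  suff -> : S`_i = w by [].
  apply: (scalerI (a := 1 - c i)); first by rewrite gt_eqF // subr_gt0.
  by rewrite scalerBl scale1r {1}ew addrC addKr.
have : gen #|(A :\ i)%SET|.
  apply/asboolP; exists (A :\ i)%SET => // j.
  apply: (hull_on_trans _ (genA j)) => k kA.
  by have [->//|ki] := eqVneq k i; apply: hull_on_mem; rewrite !inE ki.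
by move/minA; rewrite (cardsD1 i A) iA ltnn.
Qed.

(** A nonzero weight below 1 would split [x] properly between a generator and the hull; extremality
    makes the two ends equal. *)
Lemma extreme_mem x : extreme_pt (conv_hull S) x -> x \in S.
Proof.
rewrite -hull_onT => -[[l lT ->] ext]; have [l0 l1 _] := lT.
have [i li] : exists i, l i != 0.
  apply: contrapT => /forallNP l00; move: l1; rewrite big1.
    by move/eqP; rewrite eq_sym oner_eq0.
  by move=> i _; apply/eqP/negPn/negP.
suff -> : \sum_j l j *: S`_j = S`_i by rewrite mem_nth.
have [li1|li1] := ltP (l i) 1; last first.
  by apply: (conv_coef_eq1 lT); apply/eqP; rewrite eq_le li1 (conv_coef_le1 _ lT).
have [z Tz e] := hull_on_split lT li1; rewrite e.
suff <- : S`_i = z by rewrite -scalerDl addrC subrK scale1r.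
apply: (ext _ _ (l i)) => //.
- by apply: hull_on_mem; rewrite inE.
- by apply: hull_on_trans Tz => j _; apply: hull_on_mem; rewrite inE.
- by rewrite lt_def li l0.
Qed.

End ConvexHull.

(** * The estimate for one projection *)

(* The ratio of the gap [q k - q (k + 1)] to [1 + (q 0 - q k)], read off from
   the estimates in [layer_step]. *)
Definition growth {R : realType} (C M c : R) : R :=
  (4 * C ^+ 2 + 20 * M ^+ 2 + 4 * M) * (c^-1 + (4 * M)^-1) + 5 * M.

Lemma growth_ge {R : realType} (C M c : R) : 0 < c -> 0 < M ->
  5 * M <= growth C M c.
Proof.
move=> c0 M0; have ic : 0 < c^-1 by rewrite invr_gt0.
have iM : 0 < (4 * M)^-1 by rewrite invr_gt0 mulr_gt0.
by rewrite /growth lerDr mulr_ge0 //; nra.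
Qed.

(* Here [a = |p x|^2], [s = <p x, e>], [E = |e|^2] and [r = <x - p x, d>]. *)
Lemma layer_step {R : realType} (C M c E a s r q0 q q' : R) :
  0 < c -> c <= E -> E <= M -> 0 <= C -> q <= q0 ->
  growth C M c * (1 + (q0 - q)) <= q - q' ->
  a - s ^+ 2 / E <= q' -> 2 * s < E ->
  - C <= s + r -> r ^+ 2 <= (q0 - a) * M ->
  a - 2 * s + E <= q.
Proof.
move=> c0 cE EM C0 qq0 hB ha sE hs hr.
have E0 : 0 < E by lra.
have M0 : 0 < M by lra.
have hB0 := growth_ge C c0 M0.
have [s0|s0] := leP 0 s.
  (* For 0 <= s < E/2 the total error s^2/E + E is at most 5M/4. *)
  have : s ^+ 2 / E <= E / 4.
    by rewrite ler_pdivrMr // mulrAC ler_pdivlMr //; nra.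
  by move: hB; nra.
(* The negated goal bounds [a] from below, hence r^2 from above. *)
rewrite leNgt; apply/negP => hq.
have iM : 0 < (4 * M)^-1 by rewrite invr_gt0 mulr_gt0.
have ic : 0 < c^-1 by rewrite invr_gt0.
have iM1 : (4 * M)^-1 * M = 4^-1 by rewrite invfM mulfVK // gt_eqF.
have s2 : 0 <= s ^+ 2 by rewrite sqr_ge0.
have amgm : - 2 * s <= s ^+ 2 * (4 * M)^-1 + 4 * M.
  have : 0 <= (s + 4 * M) ^+ 2 * (4 * M)^-1 by rewrite mulr_ge0 ?sqr_ge0 ?ltW.
  by move: iM1; set m := (4 * M)^-1; nra.
have sr : s ^+ 2 <= 2 * C ^+ 2 + 2 * r ^+ 2.
  have : 0 <= (C - r) ^+ 2 by rewrite sqr_ge0.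
  by nra.
(* Inserting the bound on r^2 into [sr] leaves s^2/2 on the right; absorbing it doubles the
   constants. *)
set X := 4 * C ^+ 2 + 4 * M * (q0 - q) + 20 * M ^+ 2.
have hX : s ^+ 2 <= X.
  have : (q0 - a) * M <= (q0 - q + s ^+ 2 * (4 * M)^-1 + 5 * M) * M.
    by rewrite ler_pM2r //; lra.
  have -> : (q0 - q + s ^+ 2 * (4 * M)^-1 + 5 * M) * M
     = (q0 - q) * M + s ^+ 2 / 4 + 5 * M ^+ 2 by rewrite -iM1; ring.
  rewrite /X; lra.
have hc : s ^+ 2 / E <= X * c^-1.
  by apply: ler_pM => //; rewrite ?invr_ge0 ?(ltW E0) // lef_pV2 // posrE.
have hM : s ^+ 2 * (4 * M)^-1 <= X * (4 * M)^-1 by rewrite ler_pM2r.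
have hg : X * (c^-1 + (4 * M)^-1) + 5 * M <= growth C M c * (1 + (q0 - q)).
  have g0 : 0 <= q0 - q by lra.
  have : X <= (4 * C ^+ 2 + 20 * M ^+ 2 + 4 * M) * (1 + (q0 - q)).
    rewrite -subr_ge0.
    have -> : (4 * C ^+ 2 + 20 * M ^+ 2 + 4 * M) * (1 + (q0 - q)) - X =
      4 * M + (4 * C ^+ 2 + 20 * M ^+ 2) * (q0 - q) by rewrite /X; ring.
    by rewrite addr_ge0 ?mulr_ge0 //; nra.
  have -> : growth C M c * (1 + (q0 - q)) =
      (4 * C ^+ 2 + 20 * M ^+ 2 + 4 * M) * (1 + (q0 - q)) *
      (c^-1 + (4 * M)^-1) + 5 * M * (1 + (q0 - q)) by rewrite /growth; ring.
  move=> h.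
  apply: lerD; first by rewrite ler_pM2r // addr_gt0.
  by rewrite ler_peMr //; nra.
move: hg; rewrite mulrDr; lra.
Qed.

(** * Compact sets and the invariant set *)

Lemma compact_sqnorm_bounded {R : realType} {N : nat} (K : set 'rV[R]_N) :
  compact K -> eucl_bounded K.
Proof.
move=> cK.
have cf : continuous (@eucl_sqnorm R N : 'rV[R]_N -> R).
  apply: continuous_big => [|i _ x]; first exact: add_continuous.
  have h := @coord_continuous R 1 N ord0 i x; exact: (cvgM h h).
have /compact_bounded[M [_ hM]] : compact (@eucl_sqnorm R N @` K).
  by apply: continuous_compact => //; apply: continuous_subspaceT.
(* [hM] holds only for bounds strictly above [M]. *)
exists (M + 1) => x Kx; apply: le_trans (ler_norm _) _.
by apply: hM; [rewrite ltrDl|exists x].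
Qed.

Theorem theorem1p1 (R : realType) (N : nat) (S : seq 'rV[R]_N)
  (v : 'rV[R]_N -> 'rV[R]_N)
  (hv : forall x, extreme_pt (conv_hull S) (v x) /\
          (forall w, extreme_pt (conv_hull S) w ->
             eucl_sqdist x (v x) <= eucl_sqdist x w))
  (K : set 'rV[R]_N) (hK : compact K) :
  exists Q : set 'rV[R]_N,
    convex_pts Q /\ eucl_bounded Q /\ K `<=` Q /\
    (forall gamma, conv_hull S gamma ->
       forall x, Q x -> Q (x + (gamma - v x))).
Proof.
pose D := [seq a - b | a <- S, b <- S].
have [M [M0 hM]] := seq_ub D (fun d => dot d d).
have [C [C0 hC]] := seq_ub S (fun w => dot w w).
have [c [c0 hc]] := seq_pos_lb [seq (d, w) | d <- D, w <- words D (size D)]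
  (fun p => dot (oproj p.2 p.1) (oproj p.2 p.1)).
have [kappa hkappa] := compact_sqnorm_bounded hK.
pose B := growth C M c.
have B0 : 0 < B by apply: lt_le_trans (growth_ge C c0 M0); rewrite mulr_gt0.
have B1 : 1 <= 1 + B by rewrite lerDl ltW.
(* Then q 0 = q0, q k >= kappa + 1 for k <= [size D], so that K fits, and q k - q (k + 1) = B (1 +
   B)^k = B (1 + (q0 - q k)), the gap needed. *)
pose q0 : R := kappa + (1 + B) ^+ size D.
pose q k : R := q0 + 1 - (1 + B) ^+ k.
have q_le k : q k <= q0.
  by rewrite /q; have := exprn_ege1 k B1; lra.
pose Q : set 'rV[R]_N := [set x | forall ds, indep ds -> {subset ds <= D} ->
  dot (oproj ds x) (oproj ds x) <= q (size ds)].
have size_le (ds : seq 'rV[R]_N) :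
    indep ds -> {subset ds <= D} -> (size ds <= size D)%N.
  by move=> /indep_uniq uds dsD; apply: uniq_leq_size.
have Q_le x : Q x -> dot x x <= q0.
  by move=> /(_ [::] isT) h; apply: le_trans (q_le 0%N); apply: h.
have step x w : Q x -> extreme_pt (conv_hull S) w -> Q (x + (w - v x)).
  move=> Qx ew ds ids dsD; have [ev /(_ _ ew) vx] := hv x.
  have vS := extreme_mem ev; have wS := extreme_mem ew.
  rewrite -opprB linearB /=.
  set d := v x - w; have dD : d \in D by apply: allpairs_f.
  have [->|e0] := eqVneq (oproj ds d) 0; first by rewrite subr0; apply: Qx.
  have := Qx (d :: ds); rewrite dot_oproj_cons /= e0 ids => /(_ isT) Qd.
  rewrite !dotE (dotC (oproj ds d)).
  set s := dot _ (oproj ds d); set a := dot _ _; set E := dot _ _.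
  have -> : a - s + (- s - - E) = a - 2 * s + E by ring.
  (* If E <= 2s the projection does not get longer. *)
  have [sE|sE] := leP E (2 * s).
    by apply: le_trans (Qx ds ids dsD); rewrite -/a; lra.
  apply: (@layer_step _ C M c E a s (dot (x - oproj ds x) d) q0 _
    (q (size ds).+1)) => //.
  - apply: (hc (d, ds)); last by rewrite dot_gt0.
    by apply: allpairs_f => //; apply: mem_words => //; apply: size_le.
  - by apply: le_trans (dot_oproj_le _ _) _; apply: hM.
  - exact: ltW.
  - rewrite -/B /q exprS le_eqVlt; apply/orP; left; apply/eqP; ring.
  - by apply: Qd => z; rewrite inE => /predU1P[->//|/dsD].
  (* Here s + r = <x, d>, and nearness of [v x] gives 2<x, d> >= |v x|^2 - |w|^2 >= -C. *)
  - rewrite /s dot_oproj -dotDl addrC subrK.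
    move: vx; rewrite /eucl_sqdist !eucl_sqnormE /d !dotE !(dotC _ x).
    by have := dot_ge0 (v x); have := hC _ wS; lra.
  - apply: le_trans (dot_CauchySchwarz _ _) _.
    apply: ler_pM; rewrite ?dot_ge0 ?hM //.
    by rewrite dot_sub_oproj lerD2r Q_le.
exists Q; split; [|split; [|split]].
- move=> x y t Qx Qy t0 t1 ds ids dsD; rewrite linearP linearZ /=.
  have {Qx} := Qx ds ids dsD; have {Qy} := Qy ds ids dsD.
  set X := oproj ds x; set Y := oproj ds y => hY hX.
  have t1' : 0 <= 1 - t by rewrite subr_ge0.
  (* The convexity defect of the squared norm is t(1 - t)|X - Y|^2. *)
  move: (mulr_ge0 (mulr_ge0 t0 t1') (dot_ge0 (X - Y))).
  by rewrite !dotE (dotC Y X); nra.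
- by exists q0 => x Qx; rewrite eucl_sqnormE Q_le.
- move=> x Kx ds ids dsD; apply: le_trans (dot_oproj_le _ _) _.
  have := hkappa _ Kx; rewrite eucl_sqnormE => /le_trans; apply.
  have : (1 + B) ^+ size ds <= (1 + B) ^+ size D.
    by rewrite ler_weXn2l // size_le.
  by rewrite /q /q0; lra.
- move=> g /conv_hull_extreme[l [l0 l1 lext ->]] x Qx ds ids dsD.
  (* The weights sum to 1, so the translate averages the vertex steps. *)
  have -> : x + (\sum_i l i *: S`_i - v x) =
      \sum_i l i *: (x + (S`_i - v x)).
    under [RHS]eq_bigr do rewrite addrCA scalerDr.
    by rewrite big_split /= -scaler_suml l1 scale1r addrCA.
  rewrite linear_sum /=; under eq_bigr do rewrite linearZ.
  apply: dot_convex_le => // i li.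
  exact: step Qx (lext i li) _ ids dsD.
Qed.
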